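(* Let $\mathbb{F}$ be a field and let $\mathcal{E}$ be an evolution algebra over $\mathbb{F}$. Then $\mathcal{E}$ is indecomposable if and only if the graph $\Gamma(\mathcal{E},B)$ is connected for every natural basis $B$ of $\mathcal{E}$.
   Context: An algebra over a field $\mathbb{F}$ (arbitrary) is a finite-dimensional $\mathbb{F}$-vector space with a bilinear multiplication (not necessarily associative or unital). An evolution algebra is an algebra $\mathcal{E}$ with a vector space basis $B=\{e_1,\ldots,e_n\}$ such that $e_ie_j=0=e_je_i$ for all $i\neq j$ (so $\mathcal{E}$ is commutative); any such basis is called a natural basis. Writing $e_i^2=\sum_{j=1}^n\alpha_{ij}e_j$ with $\alpha_{ij}\in\mathbb{F}$, the graph $\Gamma(\mathcal{E},B)$ is the directed graph with vertex set $V=\{1,\ldots,n\}$ and edge set $E=\{(i,j)\in V\times V:\alpha_{ij}\neq 0\}$. A directed graph is connected if its vertex set is not a disjoint union of two nonempty subsets $I,J$ such that there is no edge (in either direction) between an element of $I$ and an element of $J$. An ideal of $\mathcal{E}$ is a subspace $\mathcal{I}$ with $\mathcal{E}\mathcal{I}\subseteq\mathcal{I}$ (no other condition is imposed). $\mathcal{E}$ is decomposable if there are nonzero ideals $\mathcal{I},\mathcal{J}$ with $\mathcal{E}=\mathcal{I}\oplus\mathcal{J}$; otherwise it is indecomposable. *)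

(* Defs.v *)
From mathcomp Require Import all_boot all_algebra.

Set Implicit Arguments.
Unset Strict Implicit.
Unset Printing Implicit Defensive.

Import GRing.Theory.
Local Open Scope ring_scope.

(* A finite-dimensional algebra, not necessarily associative or unital, is a
   vector space E over F together with a bilinear product mul on E. *)

Definition natural_basis (F : fieldType) (E : vectType F)
    (mul : {bilinear E -> E -> E}) (n : nat) (B : n.-tuple E) : Prop :=
  basis_of fullv B /\
  forall i j : 'I_n, i != j -> mul (tnth B i) (tnth B j) = 0.

Definition evolution_algebra (F : fieldType) (E : vectType F)
    (mul : {bilinear E -> E -> E}) : Prop :=
  exists (n : nat) (B : n.-tuple E), natural_basis mul B.

Definition structure_constant (F : fieldType) (E : vectType F)
    (mul : {bilinear E -> E -> E}) (n : nat) (B : n.-tuple E)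
    (i j : 'I_n) : F :=
  coord B j (mul (tnth B i) (tnth B i)).

Definition evolution_graph (F : fieldType) (E : vectType F)
    (mul : {bilinear E -> E -> E}) (n : nat) (B : n.-tuple E) : rel 'I_n :=
  fun i j => structure_constant mul B i j != 0.

Definition digraph_connected (V : finType) (e : rel V) : Prop :=
  ~ exists I J : {set V},
      [/\ I != set0, J != set0, I :|: J = [set: V], [disjoint I & J]
        & forall i j, i \in I -> j \in J -> ~~ e i j /\ ~~ e j i].

(* Only left multiplication is required: the algebras of interest are
   commutative. *)
Definition is_ideal (F : fieldType) (E : vectType F)
    (mul : {bilinear E -> E -> E}) (I : {vspace E}) : Prop :=
  forall x y : E, y \in I -> mul x y \in I.

Definition decomposable (F : fieldType) (E : vectType F)
    (mul : {bilinear E -> E -> E}) : Prop :=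
  exists I J : {vspace E},
    [/\ is_ideal mul I /\ is_ideal mul J, I != 0%VS, J != 0%VS,
        (I + J)%VS = fullv & directv (I + J)].

Definition indecomposable (F : fieldType) (E : vectType F)
    (mul : {bilinear E -> E -> E}) : Prop := ~ decomposable mul.

(* Main.v *)
(* Suppose E is the direct sum of ideals I and J. Projecting a natural basis
   onto I yields a spanning family of I whose members are pairwise orthogonal;
   any basis extracted from it is a natural basis of I. Doing the same for J
   and concatenating gives a natural basis of E adapted to the decomposition,
   whose graph has no edge between the two parts. Conversely, a separation of
   the graph of a natural basis splits it into bases of two complementary
   ideals. *)
Require Import Defs.
From mathcomp Require Import all_boot all_algebra.

Set Implicit Arguments.
Unset Strict Implicit.
Unset Printing Implicit Defensive.

Import GRing.Theory.
Local Open Scope ring_scope.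

(** Going from the tail to the head, a vector is kept only if it lies outside the span of the
    vectors after it. The basis is obtained as a subsequence because [pairwise] conditions pass to
    subsequences. *)
Lemma subseq_basis_span (F : fieldType) (E : vectType F) (X : seq E) :
  exists2 Y, subseq Y X & basis_of <<X>> Y.
Proof.
elim: X => [|x X [Y sYX bY]]; first by exists [::]; rewrite // span_nil nil_basis.
have [xX|xX] := boolP (x \in <<X>>%VS).
  exists Y; first exact: subseq_trans (subseq_cons X x).
  by rewrite span_cons (addv_idPr _).
exists (x :: Y); first by rewrite /= eqxx.
by rewrite /basis_of free_cons !span_cons (span_basis bY) eqxx xX (basis_free bY).
Qed.

Section Evolution.

Variables (F : fieldType) (E : vectType F) (mul : {bilinear E -> E -> E}).

(** Both orders are required because [pairwise] compares an entry only with later ones. *)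
Definition orthogonal (u v : E) := (mul u v == 0) && (mul v u == 0).

(** Replaces indices by a condition on sequences, which behaves well under mapping, extraction and
    concatenation. *)
Lemma natural_basisP n (B : n.-tuple E) :
  natural_basis mul B <-> basis_of fullv B /\ pairwise orthogonal B.
Proof.
split=> -[bB oB]; split=> //.
  apply/(pairwiseP 0) => i j; rewrite !inE size_tuple => ltin ltjn ltij.
  have neq: Ordinal ltin != Ordinal ltjn by rewrite -val_eqE /= ltn_eqF.
  have := oB _ _ neq; rewrite eq_sym in neq; have := oB _ _ neq.
  by rewrite /orthogonal !(tnth_nth 0) /= => -> ->; rewrite eqxx.
move=> i j; rewrite neq_ltn.
have {oB} oB (a b : 'I_n) : (a < b)%N -> orthogonal (tnth B a) (tnth B b).
  rewrite !(tnth_nth 0) => ltab.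
  by move/(pairwiseP 0): oB; apply; rewrite ?inE ?size_tuple.
by case/orP=> /oB/andP[/eqP ? /eqP].
Qed.

Lemma evolution_mulC : evolution_algebra mul -> commutative mul.
Proof.
case=> n [B [bB oB]] x y.
rewrite (coord_basis bB (memvf x)) (coord_basis bB (memvf y)).
rewrite !linear_sumlz; under eq_bigr do rewrite linear_sumr.
under [RHS]eq_bigr do rewrite linear_sumr.
rewrite exchange_big; apply: eq_bigr => i _; apply: eq_bigr => j _ /=.
rewrite !linearZl_LR !linearZr_LR /= -!(tnth_nth 0).
have [->|neq] := eqVneq i j; first by rewrite !scalerA mulrC.
by rewrite !oB ?scaler0 // eq_sym.
Qed.

Section Separation.

Variables (n : nat) (B : n.-tuple E).
Hypothesis bB : basis_of fullv B.

(** Split the expansion of [v] into the part [a] over [A] and the part [b] over its complement. Then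
    [b = v - a] lies in both [I] and [J], hence vanishes, and freeness kills each of its
    coefficients. *)
Lemma coord_adapted (I J : {vspace E}) (A : {set 'I_n}) :
    (I :&: J = 0)%VS ->
    (forall i, i \in A -> tnth B i \in I) ->
    (forall i, i \notin A -> tnth B i \in J) ->
  forall v j, v \in I -> j \notin A -> coord B j v = 0.
Proof.
move=> IJ0 AI AJ v j vI jA.
have defv := coord_basis bB (memvf v); rewrite (bigID (mem A)) /= in defv.
set a := (X in _ = X + _) in defv; set b := (X in _ = _ + X) in defv.
have aI: a \in I by apply: memv_suml => i /AI Bi; rewrite -tnth_nth memvZ.
have bJ: b \in J by apply: memv_suml => i /AJ Bi; rewrite -tnth_nth memvZ.
have b0: b = 0.
  apply/eqP; rewrite -memv0 -IJ0 memv_cap bJ andbT.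
  by rewrite -(addKr a b) -defv addrC memvB.
(* Padding with zero coefficients on [A] turns [b] into a sum over the whole basis, from which a
   coordinate can be read off. *)
have defb: b = \sum_(i < n) (if i \in A then 0 else coord B i v) *: B`_i.
  rewrite /b big_mkcond; apply: eq_bigr => i _ /=.
  by case: (i \in A); rewrite ?scale0r.
have := congr1 (coord B j) b0; rewrite linear0 defb.
by rewrite coord_sum_free ?(basis_free bB) // (negPf jA).
Qed.

Definition basis_part (A : {set 'I_n}) : {vspace E} :=
  (\sum_(i in A) <[tnth B i]>)%VS.

Lemma mem_basis_part (A : {set _}) i : i \in A -> tnth B i \in basis_part A.
Proof. by move=> iA; rewrite memvE; apply: (sumv_sup i). Qed.

Lemma coord_basis_part (A : {set _}) v j :
  v \in basis_part A -> j \notin A -> coord B j v = 0.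
Proof.
case/memv_sumP=> vs vsA -> jA; rewrite linear_sum big1 // => i iA.
have /vlineP[k ->] := vsA i iA; rewrite linearZ /= (tnth_nth 0).
rewrite coord_free ?(basis_free bB) //.
by case: eqVneq iA jA => [-> ->|]; rewrite ?mulr0.
Qed.

Lemma basis_part_cap A : (basis_part A :&: basis_part (~: A) = 0)%VS.
Proof.
apply/eqP; rewrite -subv0; apply/subvP=> v; rewrite memv_cap => /andP[vA vA'].
rewrite (coord_basis bB (memvf v)) big1 ?mem0v // => i _.
have [iA|iA] := boolP (i \in A).
  by rewrite (coord_basis_part vA') ?scale0r // inE iA.
by rewrite (coord_basis_part vA) ?scale0r.
Qed.

Lemma basis_part_add A : (basis_part A + basis_part (~: A) = fullv)%VS.
Proof.
apply/eqP; rewrite eqEsubv subvf; apply/subvP=> v _.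
rewrite (coord_basis bB (memvf v)) memv_suml // => i _; rewrite memvZ //.
rewrite -tnth_nth; have [iA|iA] := boolP (i \in A).
  exact: subvP (addvSl _ _) _ (mem_basis_part iA).
by apply: subvP (addvSr _ _) _ (mem_basis_part _); rewrite inE.
Qed.

Lemma basis_part_neq0 (A : {set _}) : A != set0 -> basis_part A != 0%VS.
Proof.
case/set0Pn=> i iA; apply: contraTneq (mem_basis_part iA) => ->.
by rewrite memv0 (free_not0 (basis_free bB)) ?mem_tnth.
Qed.

(** By bilinearity only products of a basis vector with one indexed by [A] matter. Such a product is
    zero or the square of the latter, and no edge leaving [A] means that this square has no
    component outside [A]. *)
Lemma basis_part_ideal (A : {set _}) :
    (forall i j : 'I_n, i != j -> mul (tnth B i) (tnth B j) = 0) ->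
    (forall i j, i \in A -> j \notin A -> ~~ evolution_graph mul B i j) ->
  is_ideal mul (basis_part A).
Proof.
move=> oB sepA x y /memv_sumP[vs vsA ->].
rewrite linear_sumr memv_suml // => i iA.
have /vlineP[k ->] := vsA i iA.
rewrite (coord_basis bB (memvf x)) linearZr_LR memvZ // linear_sumlz memv_suml //.
move=> j _; rewrite linearZl_LR memvZ // -tnth_nth.
have [->|/oB->] := eqVneq j i; last exact: mem0v.
rewrite (coord_basis bB (memvf (mul _ _))) memv_suml // => l _; rewrite -tnth_nth.
have [lA|lA] := boolP (l \in A); first by rewrite memvZ ?mem_basis_part.
have /negPn/eqP := sepA i l iA lA.
by rewrite /structure_constant => ->; rewrite scale0r mem0v.
Qed.

End Separation.

Lemma indecomposable_connected n (B : n.-tuple E) :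
  natural_basis mul B -> indecomposable mul ->
  digraph_connected (evolution_graph mul B).
Proof.
move=> [bB oB] indec [A [A' [A0 A'0 AUA' AIA' sepA]]]; apply: indec.
have defA': A' = ~: A.
  apply/setP=> i; have := congr1 (fun S : {set _} => i \in S) AUA'; rewrite !inE.
  by have := disjointFr AIA' (x := i); case: (i \in A) => // ->.
subst A'; exists (basis_part B A), (basis_part B (~: A)); split.
- split; apply: basis_part_ideal => // i j.
    by move=> iA jA; have [] := sepA i j iA; rewrite ?inE.
  by rewrite !inE negbK => iA jA; have [] := sepA j i jA; rewrite ?inE.
- exact: basis_part_neq0.
- exact: basis_part_neq0.
- exact: basis_part_add.
- exact/directv_addP/basis_part_cap.
Qed.

(** The product lies in [J] directly and in [I] after commuting the factors, since [is_ideal] speaks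
    of left multiplication only. *)
Lemma mul_ideals I J : evolution_algebra mul ->
    is_ideal mul I -> is_ideal mul J -> (I :&: J = 0)%VS ->
  forall x y, x \in I -> y \in J -> mul x y = 0.
Proof.
move=> hE idI idJ IJ0 x y xI yJ; apply/eqP.
by rewrite -memv0 -IJ0 memv_cap idJ // andbT (evolution_mulC hE) idI.
Qed.

Lemma ideal_orthogonal_basis I J : evolution_algebra mul ->
    is_ideal mul I -> is_ideal mul J ->
    (I :&: J = 0)%VS -> (I + J = fullv)%VS ->
  exists2 X, basis_of I X & pairwise orthogonal X.
Proof.
move=> hE idI idJ IJ0 IJT; have mulC := evolution_mulC hE.
have [n [B /natural_basisP[bB oB]]] := hE.
pose p := daddv_pi I J; pose q := daddv_pi J I.
have JI0: (J :&: I = 0)%VS by rewrite capvC.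
have defpq v: p v + q v = v by rewrite daddv_pi_add // IJT memvf.
have mulIJ := mul_ideals hE idI idJ IJ0.
have pI v : p v \in I by apply: memv_pi.
have qJ v : q v \in J by apply: memv_pi.
(* The mixed products of [I] and [J] vanish, so [mul u v] is the sum of [mul (p u) (p v)] and
   [mul (q u) (q v)]. If it is zero, the first summand is minus the second, so it lies in both
   ideals. *)
have mulp u v : mul u v = 0 -> mul (p u) (p v) = 0.
  rewrite -{1}(defpq u) -{1}(defpq v) linearDl !linearDr /=.
  rewrite (mulIJ _ _ (pI u) (qJ v)) (mulC (q u)) (mulIJ _ _ (pI v) (qJ u)).
  rewrite addr0 add0r => /eqP; rewrite addr_eq0 => /eqP pq.
  apply/eqP; rewrite -memv0 -IJ0 memv_cap idI //= pq memvN.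
  exact: idJ.
(* The projection [p] maps into [I] and fixes [I] pointwise, so its image is exactly [I]. *)
have spanp: <<[seq p v | v <- B]>>%VS = I.
  rewrite -limg_span (span_basis bB); apply/eqP; rewrite eqEsubv.
  apply/andP; split; apply/subvP=> v; first by case/memv_imgP=> u _ ->.
  by move=> vI; rewrite -(daddv_pi_id IJ0 vI) memv_img ?memvf.
have [X sX bX] := subseq_basis_span [seq p v | v <- B].
exists X; first by rewrite -spanp.
apply: subseq_pairwise sX _; rewrite pairwise_map; apply: sub_pairwise oB => u v.
by case/andP=> /eqP/mulp uv /eqP/mulp vu; rewrite /orthogonal /= uv vu eqxx.
Qed.

Lemma decomposable_natural_basis : evolution_algebra mul -> decomposable mul ->
  exists n (B : n.-tuple E),
    natural_basis mul B /\ ~ digraph_connected (evolution_graph mul B).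
Proof.
move=> hE [I [J [[idI idJ] I0 J0 IJT /directv_addP IJ0]]].
have JI0: (J :&: I = 0)%VS by rewrite capvC.
have JIT: (J + I = fullv)%VS by rewrite addvC.
have [X bX oX] := ideal_orthogonal_basis hE idI idJ IJ0 IJT.
have [Y bY oY] := ideal_orthogonal_basis hE idJ idI JI0 JIT.
have mulIJ := mul_ideals hE idI idJ IJ0.
have nonnil (U : {vspace E}) Z : basis_of U Z -> U != 0%VS -> (0 < size Z)%N.
  by case: Z => // /span_basis <-; rewrite span_nil eqxx.
pose B := in_tuple (X ++ Y).
have bB: basis_of fullv B by rewrite -IJT cat_basis //; apply/directv_addP.
pose A := [set i : 'I_(size (X ++ Y)) | (i < size X)%N].
have AI i : i \in A -> tnth B i \in I.
  by rewrite inE (tnth_nth 0) nth_cat => ltiX; rewrite ltiX (basis_mem bX) ?mem_nth.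
have AJ i : i \notin A -> tnth B i \in J.
  rewrite inE (tnth_nth 0) nth_cat => geiX; rewrite (negPf geiX).
  have ltiY: (i - size X < size Y)%N by rewrite ltn_subLR -?size_cat // leqNgt.
  exact: basis_mem bY (mem_nth 0 ltiY).
exists _, B; split.
  apply/natural_basisP; split=> //; rewrite pairwise_cat oX oY !andbT.
  apply/allrelP=> x y /(basis_mem bX) xI /(basis_mem bY) yJ.
  by rewrite /orthogonal (evolution_mulC hE y) mulIJ ?eqxx.
apply; exists A, (~: A); split.
(* Index [0] points into [X]; below, index [size X] points to the first entry of [Y]. Both exist
   because the ideals are nonzero. *)
- have ltX: (0 < size (X ++ Y))%N by rewrite size_cat ltn_addr ?(nonnil I).
  by apply/set0Pn; exists (Ordinal ltX); rewrite inE /= (nonnil I).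
- have ltX: (size X < size (X ++ Y))%N.
    by rewrite size_cat -[ltnLHS]addn0 ltn_add2l (nonnil J).
  by apply/set0Pn; exists (Ordinal ltX); rewrite !inE /= ltnn.
- exact: setUCr.
- by rewrite -setI_eq0 setICr.
move=> i j iA; rewrite in_setC => jA; rewrite /evolution_graph /structure_constant.
have AI' l : l \in ~: A -> tnth B l \in J by rewrite in_setC; apply: AJ.
have AJ' l : l \notin ~: A -> tnth B l \in I by rewrite in_setC negbK; apply: AI.
(* The square of a basis vector from [I] stays in [I], so its coordinates outside [A] are zero. The
   reverse direction is the same argument with [I] and [J] exchanged and [A] replaced by its
   complement. *)
rewrite (coord_adapted bB IJ0 AI AJ) ?idI ?AI //.
by rewrite (coord_adapted bB JI0 AI' AJ') ?idJ ?AJ ?eqxx // in_setC negbK.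
Qed.

End Evolution.

Theorem proposition2p10 (F : fieldType) (E : vectType F)
    (mul : {bilinear E -> E -> E}) (hE : evolution_algebra mul) :
  indecomposable mul <->
  (forall (n : nat) (B : n.-tuple E),
      natural_basis mul B -> digraph_connected (evolution_graph mul B)).
Proof.
split=> [indec n B nB | conn dec].
  exact: indecomposable_connected.
have [n [B [nB]]] := decomposable_natural_basis hE dec.
by apply; apply: conn.
Qed.
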